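(* Let $n\ge 2$ be an integer. If $H \in \mathcal{H}_n$, then $\gamma^{\rm ID}(H\Box K_2) = |V(H)|$.
   Context: All graphs are finite, simple and undirected. For an integer $n\ge 2$, $\mathcal{H}_n$ is the class of all finite graphs that can be obtained from some connected graph $F$ of order $n$ by attaching, to each of the $n$ vertices of $F$, at least one new vertex of degree $1$ adjacent to it (the number of attached degree-1 vertices may vary from vertex to vertex). $N[x]$ denotes the closed neighborhood of a vertex $x$. An identifying code (ID code) of a graph $F$ is a set $C\subseteq V(F)$ such that $N[x]\cap C\neq\emptyset$ for every vertex $x$ and $N[x]\cap C\neq N[y]\cap C$ for all distinct vertices $x,y$; $\gamma^{\rm ID}(F)$ is the minimum cardinality of an ID code of $F$. $\Box$ denotes the Cartesian product of graphs. *)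

(* Defs.v *)
From mathcomp Require Import all_boot.

Set Implicit Arguments.
Unset Strict Implicit.
Unset Printing Implicit Defensive.

Record sgraph := SGraph {
  vertex :> finType;
  adj : rel vertex;
  adj_sym : symmetric adj;
  adj_irr : irreflexive adj
}.

Arguments adj {s}.

Definition isomorphic (G H : sgraph) : Prop :=
  exists2 f : G -> H, bijective f & {mono f : x y / adj x y}.

(* The graph without vertices also satisfies this predicate; it is only used
   for graphs of order at least 2. *)
Definition connected (G : sgraph) : Prop := forall x y : G, connect adj x y.

Definition closed_nbhd (G : sgraph) (x : G) : {set G} :=
  [set y | (y == x) || adj x y].

Definition id_code (G : sgraph) (C : {set G}) : bool :=
  [forall x, closed_nbhd x :&: C != set0] &&
  [forall x, forall y, (x != y) ==>
    (closed_nbhd x :&: C != closed_nbhd y :&: C)].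

(* If G has two distinct vertices with equal closed neighborhoods, it has no
   identifying code, and then the value is the dummy #|G|. *)
Definition gammaID (G : sgraph) : nat :=
  #|[arg min_(C < [set: G] | id_code C) #|C|]|.

Lemma id_codeS (G : sgraph) (C D : {set G}) :
  C \subset D -> id_code C -> id_code D.
Proof.
move=> sCD /andP[/forallP dom /forallP sep]; apply/andP; split; apply/forallP.
  move=> x; apply: contraNneq (dom x) => E.
  by rewrite -subset0 -E setIS.
move=> x; apply/forallP => y; apply/implyP => nxy.
apply: contraNneq (implyP (forallP (sep x) y) nxy) => E.
by rewrite -(setIidPr sCD) !setIA E.
Qed.

Lemma gammaIDP (G : sgraph) (C : {set G}) : id_code C ->
  (exists2 D : {set G}, id_code D & #|D| = gammaID G) /\
  (forall D : {set G}, id_code D -> gammaID G <= #|D|).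
Proof.
move=> /(id_codeS (subsetT C)) idT; rewrite /gammaID.
by case: arg_minnP => // D idD minD; split; first by exists D.
Qed.

Section Complete.

Variable n : nat.

Definition complete_adj : rel 'I_n := fun i j => i != j.

Lemma complete_adj_sym : symmetric complete_adj.
Proof. by move=> i j; rewrite /complete_adj eq_sym. Qed.

Lemma complete_adj_irr : irreflexive complete_adj.
Proof. by move=> i; rewrite /complete_adj eqxx. Qed.

Definition complete : sgraph := SGraph complete_adj_sym complete_adj_irr.

End Complete.

Section CartesianProduct.

Variables G H : sgraph.

Definition cartesian_adj : rel (G * H) := fun u v =>
  ((u.1 == v.1) && adj u.2 v.2) || (adj u.1 v.1 && (u.2 == v.2)).

Lemma cartesian_adj_sym : symmetric cartesian_adj.
Proof.
move=> u v; rewrite /cartesian_adj (eq_sym u.1) (eq_sym u.2).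
by rewrite (adj_sym u.1) (adj_sym u.2).
Qed.

Lemma cartesian_adj_irr : irreflexive cartesian_adj.
Proof. by move=> u; rewrite /cartesian_adj !adj_irr andbF. Qed.

Definition cartesian : sgraph := SGraph cartesian_adj_sym cartesian_adj_irr.

End CartesianProduct.

Section AttachLeaves.

Variables (F : sgraph) (k : F -> nat).

(* inl x is the original vertex x of F; inr (Tagged _ i) with tag x is the
   i-th of the k x new vertices attached to x. *)
Definition attach_adj : rel (F + {x : F & 'I_(k x)}) := fun u v =>
  match u, v with
  | inl x, inl y => adj x y
  | inl x, inr l => tag l == x
  | inr l, inl y => tag l == y
  | inr _, inr _ => false
  end.

Lemma attach_adj_sym : symmetric attach_adj.
Proof. by move=> [x|l] [y|m] //=; rewrite adj_sym. Qed.

Lemma attach_adj_irr : irreflexive attach_adj.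
Proof. by move=> [x|l] //=; rewrite adj_irr. Qed.

Definition attach_leaves : sgraph := SGraph attach_adj_sym attach_adj_irr.

End AttachLeaves.

Definition class_H (n : nat) (H : sgraph) : Prop :=
  exists (F : sgraph) (k : F -> nat),
    [/\ connected F, #|F| = n, forall x : F, 0 < k x
      & isomorphic H (attach_leaves k)].

(* Main.v *)
(** Upper bound: one layer of the prism over a graph without isolated vertices
    and without closed twins is an identifying code, and the graphs in the
    class have neither. Lower bound: let x be a vertex of F with k leaves.
    Separating the two copies of a leaf of x forces a code to contain a copy of
    x. If it contains just one, then domination forces a copy of each leaf of
    x; if it contains both, then separation allows at most one leaf without a
    copy in the code. Either way the code has at least k + 1 vertices above x
    and its leaves. *)
Require Import Defs.
From mathcomp Require Import all_boot.

Set Implicit Arguments.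
Unset Strict Implicit.
Unset Printing Implicit Defensive.

Lemma isomorphic_sym (G H : sgraph) : isomorphic G H -> isomorphic H G.
Proof.
case=> f [g fK gK] f_mono; exists g; first by exists f.
by move=> x y; rewrite -f_mono !gK.
Qed.

Lemma isomorphic_cartesianl (G H K : sgraph) :
  isomorphic G H -> isomorphic (cartesian G K) (cartesian H K).
Proof.
case=> f [g fK gK] f_mono; exists (fun u : G * K => (f u.1, u.2)).
  by exists (fun u : H * K => (g u.1, u.2)) => -[u i] /=; rewrite ?fK ?gK.
move=> [u i] [v j]; rewrite /adj /= /cartesian_adj /= f_mono.
by rewrite (inj_eq (can_inj fK)).
Qed.

Lemma id_codeP (G : sgraph) (C : {set G}) :
  reflect ((forall x, exists2 y, y \in closed_nbhd x & y \in C) /\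
           (forall x y, (forall z, z \in C ->
              (z \in closed_nbhd x) = (z \in closed_nbhd y)) -> x = y))
          (id_code C).
Proof.
apply: (iffP andP) => -[dom sep]; split.
- move=> x; have /set0Pn[y] := forallP dom x.
  by rewrite inE => /andP[]; exists y.
- move=> x y eqxy; apply/eqP; apply: contraT => nxy.
  have /eqP[] := implyP (forallP (forallP sep x) y) nxy.
  apply/setP => z; rewrite !inE; case: (boolP (z \in C)); rewrite ?andbF //.
  by move=> /eqxy; rewrite !inE => ->.
- apply/forallP => x; have [y xy Cy] := dom x.
  by apply/set0Pn; exists y; rewrite inE xy.
- apply/forallP => x; apply/forallP => y; apply/implyP; apply: contra => /eqP E.
  by apply/eqP/sep => z Cz; move/setP/(_ z): E; rewrite !in_setI Cz !andbT.
Qed.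

Lemma id_code_isomorphic (G H : sgraph) (D : {set H}) :
  isomorphic G H -> id_code D -> exists2 C : {set G}, id_code C & #|C| = #|D|.
Proof.
case=> f f_bij f_mono /id_codeP[dom sep]; have [g fK gK] := f_bij.
have f_inj := can_inj fK.
have nbhdE x y : (f y \in closed_nbhd (f x)) = (y \in closed_nbhd x).
  by rewrite !inE f_mono (inj_eq f_inj).
exists (f @^-1: D); last by rewrite on_card_preimset //; apply: onW_bij.
apply/id_codeP; split=> [x | x y E].
  have [y xy Dy] := dom (f x).
  by exists (g y); [rewrite -nbhdE gK | rewrite inE gK].
apply/f_inj/sep => z Dz; rewrite -(gK z) !nbhdE.
by apply: E; rewrite inE gK.
Qed.

(** The code in the first premise also rules out the dummy value of [gammaID]. *)
Lemma gammaID_eq (G : sgraph) (m : nat) :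
  (exists2 C : {set G}, id_code C & #|C| = m) ->
  (forall C : {set G}, id_code C -> m <= #|C|) -> gammaID G = m.
Proof.
case=> C idC cardC minC; have [[D idD cardD] minD] := gammaIDP idC.
by apply/eqP; rewrite eqn_leq -{1}cardC minD //= -cardD minC.
Qed.

Lemma gammaID_isomorphic (G H : sgraph) (m : nat) : isomorphic G H ->
  (exists2 C : {set H}, id_code C & #|C| = m) ->
  (forall C : {set H}, id_code C -> m <= #|C|) -> gammaID G = m.
Proof.
move=> GH [C idC <-] minC; apply: gammaID_eq.
  exact: id_code_isomorphic GH idC.
move=> D /(id_code_isomorphic (isomorphic_sym GH))[D' idD' <-].
exact: minC.
Qed.

Local Notation prism G := (cartesian G (complete 2)).

(** Both copies of [u] lie in the closed neighborhood, so the layer matters only for proper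
    neighbors. *)
Lemma in_closed_nbhd_prism (G : sgraph) (u v : G) (i j : 'I_2) :
  (((v, j) : prism G) \in closed_nbhd ((u, i) : prism G)) =
  (v == u) || (adj u v && (i == j)).
Proof.
rewrite inE /adj /= /cartesian_adj /adj /= /complete_adj xpair_eqE.
by rewrite (eq_sym u v) (eq_sym j i); case: (i == j); case: (v == u).
Qed.

(** Seen from layer 0, a vertex [(u, ord0)] has trace N[u] and [(u, ord_max)] has trace {u}. Traces
    of the first kind differ as there are no twins, those of the second kind are distinct
    singletons, and N[u] is never a singleton. *)
Lemma prism_layer_id_code (G : sgraph) :
  (forall x : G, exists y, adj x y) -> injective (@closed_nbhd G) ->
  exists2 C : {set prism G}, id_code C & #|C| = #|G|.
Proof.
move=> G_noniso G_twinfree.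
pose layer (x : G) : prism G := (x, ord0).
have layer_inj : injective layer by move=> x y [].
exists (layer @: [set: G]); last by rewrite card_imset // cardsT.
apply/id_codeP; split.
  move=> [u i]; exists (layer u); first by rewrite in_closed_nbhd_prism eqxx.
  exact: imset_f.
(* If N[u] = {w}, then both [u] and its neighbor equal [w], which gives a loop. *)
have iso_contra (u w : G) :
    ~ (forall v, (v == u) || adj u v = (v == w)).
  move=> E; have [v uv] := G_noniso u.
  move: (E u) (E v); rewrite eqxx uv orbT => /esym/eqP <- /esym/eqP vu.
  by rewrite vu adj_irr in uv.
have ord2P (i : 'I_2) : i = ord0 \/ (i == ord0) = false /\ i = ord_max.
  by case: i => [[|[|//]] ?]; [left | right; split => //]; apply: val_inj.
move=> [u i] [w j] E.
have {}E v : (v == u) || (adj u v && (i == ord0)) =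
             (v == w) || (adj w v && (j == ord0)).
  have := E (layer v); rewrite !in_closed_nbhd_prism; apply.
  exact: imset_f.
case: (ord2P i) (ord2P j) E => [->|[-> ->]] [->|[-> ->]] E.
- congr pair; apply: G_twinfree; apply/setP => v.
  by have := E v; rewrite !inE !andbT.
- case: (iso_contra u w) => v.
  by have := E v; rewrite andbT andbF orbF.
- case: (iso_contra w u) => v.
  by have := E v; rewrite andbT andbF orbF.
- by have := E u; rewrite !andbF !orbF eqxx => /esym/eqP->.
Qed.

Lemma connected_neighbor (G : sgraph) (x : G) :
  connected G -> 1 < #|G| -> exists y, adj x y.
Proof.
move=> G_conn /card_gt1P[y [z [_ _ nyz]]].
have [w nwx] : exists w, w != x.
  by have [<-|] := eqVneq y x; [exists z; rewrite eq_sym | exists y].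
(* The neighbor is the first step of a path from [x] to some [w] other than [x]. *)
have /connectP[[|v p] /= xp E] := G_conn x w; first by rewrite E eqxx in nwx.
by exists v; case/andP: xp.
Qed.

Section AttachLeavesPrism.

Variables (F : sgraph) (k : F -> nat).
Hypothesis k_gt0 : forall x, 0 < k x.

Let H := attach_leaves k.
Let leaf x (i : 'I_(k x)) : H := inr (Tagged (fun x => 'I_(k x)) i).

Lemma attach_leaves_noniso (x : H) : exists y, adj x y.
Proof.
case: x => [x|l]; last by exists (inl (tag l)); rewrite /adj /= eqxx.
by exists (leaf (Ordinal (k_gt0 x))); rewrite /adj /= eqxx.
Qed.

Lemma attach_leaves_twinfree :
  (forall x : F, exists y, adj x y) -> injective (@closed_nbhd H).
Proof.
move=> F_noniso.
have mixed x l : closed_nbhd (inl x : H) <> closed_nbhd (inr l : H).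
  move=> /setP E; have [y xy] := F_noniso x.
  (* The neighbor [y] in [F] must be the stem of [l], while the chosen leaf of [x] must be [l]
     itself; hence [y] is [x]. *)
  have := E (leaf (Ordinal (k_gt0 x))); have := E (inl y).
  rewrite !inE /adj /= xy orbT eqxx /= orbF => /esym/eqP ly /esym/eqP[lx].
  by rewrite -ly -lx /= adj_irr in xy.
move=> [x|l] [y|m] E.
- have /setP/(_ (leaf (Ordinal (k_gt0 x)))) := E.
  by rewrite !inE /adj /= eqxx => /esym/eqP->.
- by case: (mixed x m).
- by case: (mixed y l).
- have /setP/(_ (inr l)) := E; rewrite !inE /adj /= eqxx /= orbF.
  by move=> /esym/eqP.
Qed.

(** Groups each vertex of [F] with its leaves, so that the lower bound can be checked group by
    group. *)
Lemma sum_attach_leaves (f : H -> nat) :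
  \sum_(u : H) f u = \sum_(x : F) (f (inl x) + \sum_(i < k x) f (leaf i)).
Proof.
rewrite big_sumType big_split /=; congr (_ + _)%N.
by rewrite (sig_big_dep (fun=> true) (fun _ _ => true)
              (fun x i => f (leaf i))) /=; apply: eq_bigr => -[x i].
Qed.

Lemma card_attach_leaves_prism (D : {set prism H}) :
  #|D| = \sum_(u : H) \sum_(i < 2) (((u, i) : prism H) \in D).
Proof.
rewrite pair_big -sum1_card big_mkcond /=.
by apply: eq_bigr => -[u i] _ /=; case: ifP.
Qed.

Lemma id_code_attach_leaves_prism (D : {set prism H}) :
  id_code D -> #|H| <= #|D|.
Proof.
case/id_codeP => dom sep; rewrite card_attach_leaves_prism -sum1_card.
rewrite !sum_attach_leaves; apply: leq_sum => x _.
rewrite sum1_card card_ord.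
pose c (u : H) := \sum_(i < 2) (((u, i) : prism H) \in D).
change (1 + k x <= c (inl x) + \sum_(i < k x) c (leaf i)).
have c_gt0 u i : ((u, i) : prism H) \in D -> 0 < c u.
  by move=> Dui; rewrite /c (bigD1 i) //= Dui.
have c_eq0 u i : c u = 0 -> (((u, i) : prism H) \in D) = false.
  by move=> cu0; apply: contraTF isT => /c_gt0; rewrite cu0.
have adj_leaf (i : 'I_(k x)) (v : H) : adj (leaf i) v = (v == inl x).
  by case: v => [y|m]; rewrite /adj //= eq_sym.
(* The closed neighborhoods of the two copies of a leaf differ only in the copies of its stem. *)
have c_stem : 0 < c (inl x).
  rewrite lt0n; apply/eqP => cx0; pose l := leaf (Ordinal (k_gt0 x)).
  suff: (l, ord0) = (l, ord_max) :> prism H by case.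
  apply: sep => -[v j] Dvj; rewrite !in_closed_nbhd_prism !adj_leaf.
  by case: (v =P inl x) => [Ev|//]; rewrite Ev c_eq0 in Dvj.
(* In one layer, the closed neighborhoods of two leaves of [x] share the copy of [x] and differ only
   in copies of these leaves, none of which is in [D]. *)
have leaf_unique (i j : 'I_(k x)) : c (leaf i) = 0 -> c (leaf j) = 0 -> i = j.
  move=> ci cj; suff: (leaf i, ord0) = (leaf j, ord0) :> prism H.
    by case=> /eqP; rewrite eq_Tagged => /eqP.
  apply: sep => -[v h] Dvh; rewrite !in_closed_nbhd_prism !adj_leaf.
  case: (v =P leaf i) => [Ev|_]; first by rewrite Ev c_eq0 in Dvh.
  by case: (v =P leaf j) => [Ev|//]; rewrite Ev c_eq0 in Dvh.
(* In each layer [j], only [(inl x, j)] is left to dominate the copy of the leaf. *)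
have stem_full (i : 'I_(k x)) : c (leaf i) = 0 -> c (inl x) = 2.
  move=> ci0; have stem_in j : ((inl x, j) : prism H) \in D.
    have [[v h]] := dom (leaf i, j); rewrite in_closed_nbhd_prism adj_leaf.
    by case/orP=> [/eqP-> | /andP[/eqP-> /eqP->] //]; rewrite c_eq0.
  by rewrite /c !big_ord_recl big_ord0 !stem_in.
(* If every leaf has a copy in [D], the count is at least 1 + [k x]. Otherwise the stem counts 2 and
   all leaves but [i0] at least 1 each, giving 2 + ([k x] - 1). *)
have [/existsP[i0 /eqP ci0] | all_pos] :=
  boolP [exists i : 'I_(k x), c (leaf i) == 0]; last first.
  apply: leq_add => //; rewrite -[X in X <= _]card_ord -sum1_card.
  by apply: leq_sum => i _; rewrite lt0n; exact: (existsPn all_pos).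
rewrite (stem_full _ ci0) (bigD1 i0) //= ci0 add0n addSn ltnS.
rewrite -[X in X <= _]card_ord -sum1_card (bigD1 i0) //= leq_add2l.
apply: leq_sum => i; rewrite lt0n; apply: contraNneq => ci.
exact/eqP/leaf_unique.
Qed.

End AttachLeavesPrism.

Theorem proposition9 (n : nat) (hn : 2 <= n) (H : sgraph) (hH : class_H n H) :
  gammaID (cartesian H (complete 2)) = #|H|.
Proof.
case: hH => F [k [F_conn cardF k_gt0 HF]].
have F_noniso x : exists y : F, adj x y.
  by apply: connected_neighbor; rewrite ?cardF.
have -> : #|H| = #|attach_leaves k| by case: HF => f /bij_eq_card.
apply: (gammaID_isomorphic (isomorphic_cartesianl _ HF)).
  apply: prism_layer_id_code; first exact: attach_leaves_noniso.
  exact: attach_leaves_twinfree.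
exact: id_code_attach_leaves_prism.
Qed.
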